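(* Let $m\ge 1$ be an integer. Then the map $$\Delta:\{z\text{-superstable configurations of }-C_{2m+1}\}\to\{\text{critical configurations of }-C_{2m+1}\},\qquad \vec{c}\mapsto\vec{\epsilon}_{-C_{2m+1}}+\vec{c},$$ is a (well-defined) bijection, where $\vec{\epsilon}_{-C_{2m+1}}$ is the identity of the critical group $\mathcal{K}(-C_{2m+1})$.
   Context: $-C_{2m+1}$ is the signed cycle on $2m+1$ vertices with sink $q=v_{2m+1}$ and nonsink vertices $v_1,\dots,v_{2m}$ (in cyclic order), in which every edge not incident to $q$ is negative. Its reduced signed Laplacian is the $2m\times 2m$ matrix $L$ with $L_{ii}=2$, $L_{ij}=+1$ if $|i-j|=1$, and $0$ otherwise. Let $M$ be the reduced Laplacian of the unsigned cycle: $M_{ii}=2$, $M_{ij}=-1$ if $|i-j|=1$, and $0$ otherwise. Put $n=2m$. The valid configurations are $S^+=\{\vec{c}\in\mathbb{Z}^n: ML^{-1}\vec{c}\ge\vec{0}\}$ (entrywise). For $\vec{c}\in S^+$: site $i$ is ready to fire if $\vec{c}-L\vec{e}_i\in S^+$, and replacing $\vec{c}$ by $\vec{c}-L\vec{e}_i$ is then a legal firing; $\vec{c}$ is stable if no site is ready to fire; $\vec{c}$ is $z$-superstable if $\vec{c}-L\vec{z}\notin S^+$ for all nonzero $\vec{z}\in\mathbb{Z}^n_{\ge0}$; $\vec{c}$ is reachable if there is $\vec{d}\in S^+$ at which every site is ready to fire and from which $\vec{c}$ is obtained by a finite sequence of legal firings; $\vec{c}$ is critical if it is stable and reachable. The critical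 group is $\mathcal{K}(-C_{2m+1})=\mathbb{Z}^n/\mathrm{im}\,L$; each class contains exactly one critical configuration (a theorem of Guzmán and Klivans), and $\vec{\epsilon}_{-C_{2m+1}}$ is the critical configuration in the class of $\vec{0}$. *)

(* Defs.v *)
From mathcomp Require Import all_boot all_order all_algebra.
From mathcomp Require Import boolp classical_sets functions.
From Stdlib Require Import Relation_Operators.

Set Implicit Arguments.
Unset Strict Implicit.
Unset Printing Implicit Defensive.

Import Order.TTheory GRing.Theory Num.Theory.

Local Open Scope classical_set_scope.
Local Open Scope ring_scope.

(* Configurations are integer column vectors indexed by the nonsink vertices.
   The chip-firing notions are relative to a pair (L, M): L is the reduced
   Laplacian of the signed graph, M that of the underlying unsigned graph.
   Both are integral; L^-1 is taken over rat, and invmx is the true inverse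
   only when L is nonsingular (for the signed cycles below, \det L = 2m + 1). *)

Definition valid (n : nat) (L M : 'M[int]_n) : set 'cV[int]_n :=
  [set c | forall i : 'I_n,
     0 <= (map_mx intr M *m invmx (map_mx intr L) *m map_mx intr c
             : 'cV[rat]_n) i 0].

Definition fire (n : nat) (L : 'M[int]_n) (i : 'I_n) (c : 'cV[int]_n) :
  'cV[int]_n := c - L *m delta_mx i 0.

Definition ready (n : nat) (L M : 'M[int]_n) (i : 'I_n) (c : 'cV[int]_n) :
  Prop := valid L M (fire L i c).

Definition legal_firing (n : nat) (L M : 'M[int]_n) (c d : 'cV[int]_n) : Prop :=
  valid L M c /\ exists i : 'I_n, ready L M i c /\ d = fire L i c.

Definition stable (n : nat) (L M : 'M[int]_n) : set 'cV[int]_n :=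
  [set c | valid L M c /\ forall i : 'I_n, ~ ready L M i c].

Definition z_superstable (n : nat) (L M : 'M[int]_n) : set 'cV[int]_n :=
  [set c | valid L M c /\
     forall z : 'cV[int]_n, (forall i, 0 <= z i 0) -> z != 0 ->
       ~ valid L M (c - L *m z)].

Definition reachable (n : nat) (L M : 'M[int]_n) : set 'cV[int]_n :=
  [set c | exists d : 'cV[int]_n,
     [/\ valid L M d, (forall i : 'I_n, ready L M i d) &
         clos_refl_trans _ (legal_firing L M) d c]].

Definition critical (n : nat) (L M : 'M[int]_n) : set 'cV[int]_n :=
  stable L M `&` reachable L M.

(* Equality of classes in the critical group Z^n / im L. *)
Definition same_class (n : nat) (L : 'M[int]_n) (c d : 'cV[int]_n) : Prop :=
  exists z : 'cV[int]_n, c - d = L *m z.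

(* The critical configuration in the class of 0. It exists and is unique by a
   theorem of Guzman and Klivans, so the default value of xget is irrelevant. *)
Definition critical_identity (n : nat) (L M : 'M[int]_n) : 'cV[int]_n :=
  xget 0 [set c | critical L M c /\ same_class L c 0].

Definition adjacent (n : nat) (i j : 'I_n) : bool :=
  (i.+1 == j :> nat) || (j.+1 == i :> nat).

(* -C_(2m+1): the nonsink vertices v_1, ..., v_(2m) are the ordinals
   0, ..., 2m-1, and the edges between them are negative. *)
Definition signed_cycle_laplacian (m : nat) : 'M[int]_(2 * m) :=
  \matrix_(i, j) if i == j then 2 else if adjacent i j then 1 else 0.

Definition unsigned_cycle_laplacian (m : nat) : 'M[int]_(2 * m) :=
  \matrix_(i, j) if i == j then 2 else if adjacent i j then -1 else 0.

(* Main.v *)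
Require Import Defs.
From mathcomp Require Import all_boot all_order all_algebra.
From mathcomp Require Import boolp classical_sets functions.
From mathcomp Require Import ring lra zify.
From Stdlib Require Import Relation_Operators Operators_Properties.

Set Implicit Arguments.
Unset Strict Implicit.
Unset Printing Implicit Defensive.

Import Order.TTheory GRing.Theory Num.Theory.
Local Open Scope ring_scope.

(** Write L and M for the signed and unsigned reduced Laplacians of the cycle
    with n nonsink vertices, N = n + 1 odd, and attach to a configuration c
    the rational vector h = M L^-1 c of its heights.  Validity says h >= 0,
    and firing site i subtracts M e_i from h: seen through heights, the signed
    game is ordinary chip-firing on the unsigned cycle, with rational chips.

    On the unsigned cycle the usual arguments bound heights.  If c is
    z-superstable, all heights lie in [0, 2) and at most one is >= 1, since an
    interval whose two ends both have height >= 1 could be fired at once.  If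
    c is critical, all heights lie in [0, 2) and at most one is < 1, since an
    interval with two low ends would be a forbidden subconfiguration, and a
    reachable configuration has none (reachable_recurrent).

    Integrality of c excludes the exceptional site in both cases
    (heights_no_exception).  The potential x = L^-1 c satisfies
    x_k = (-1)^(k+1) k x_1 mod Z, and N is odd, so x_k = x_(N-k) mod Z: the
    difference h - (h reversed) is M y for an integral y.  Pairing with
    (1, 2, ..., n) shows that the sum of k (h_k - h_(N-k)) is a multiple of N.
    If exactly the height at i were off by +1 or -1 from the unit interval
    containing the others, this sum would be 2i - N up to sign, and N odd with
    0 < i < N forbids that N divides it.

    Hence z-superstable means that all heights lie in [0, 1)
    (z_superstableE), and critical that all lie in [1, 2) (criticalE).  The
    converses come from a discrete maximum principle (exists_descent).  A
    critical configuration in the class of 0 has integral heights in [1, 2),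
    so all its heights are 1; one exists because M z = 1 has the integral
    solution z_k = k (N - k) / 2, again as N is odd.  Adding the identity
    therefore translates heights by 1 and carries [0, 1) onto [1, 2). *)

(** * The tridiagonal matrices of a cycle *)

(** Column vectors become functions on all naturals, indexed from 1 and
    vanishing at the two copies 0 and n + 1 of the sink, so that tridiagonal
    products have no boundary cases. *)
Definition pad (R : pzRingType) (n : nat) (x : 'cV[R]_n) (k : nat) : R :=
  \sum_(j < n) (j.+1 == k)%:R * x j 0.

Lemma pad0 (R : pzRingType) (n : nat) (x : 'cV[R]_n) : pad x 0 = 0.
Proof. by rewrite /pad big1 // => j _; rewrite mul0r. Qed.

Lemma padE (R : pzRingType) (n : nat) (x : 'cV[R]_n) (i : 'I_n) :
  pad x i.+1 = x i 0.
Proof.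
rewrite /pad (bigD1 i) //= eqxx mul1r big1 ?addr0 // => j ji.
by rewrite eqSS (inj_eq val_inj) (negPf ji) mul0r.
Qed.

Lemma pad_gt (R : pzRingType) (n k : nat) (x : 'cV[R]_n) :
  (n < k)%N -> pad x k = 0.
Proof.
move=> nk; rewrite /pad big1 // => j _; rewrite (_ : (_ == _) = false) ?mul0r //.
by apply/eqP; have := ltn_ord j; lia.
Qed.

Lemma padP (R : pzRingType) (n : nat) (x : 'cV[R]_n) (k : nat) :
  pad x k = 0 \/ exists2 j : 'I_n, k = j.+1 & pad x k = x j 0.
Proof.
case: k => [|k]; first by left; exact: pad0.
have [kn|nk] := ltnP k n; last by left; exact: pad_gt.
by right; exists (Ordinal kn) => //; exact: (padE x (Ordinal kn)).
Qed.

Lemma pad_rev (R : pzRingType) (n : nat) (x : 'cV[R]_n) (k : nat) :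
  (k <= n.+1)%N -> pad (\col_i x (rev_ord i) 0) k = pad x (n.+1 - k).
Proof.
case: k => [|k] kn; first by rewrite pad0 subn0 pad_gt.
have [nk|{}kn] := leqP n k; first by rewrite pad_gt // subSS (eqP nk) pad0.
rewrite (padE _ (Ordinal kn)) mxE -(padE x) /=; congr pad; lia.
Qed.

Definition cycle_laplacian (R : pzRingType) (n : nat) (s : R) : 'M[R]_n :=
  \matrix_(i, j) if i == j then 2 else if adjacent i j then s else 0.

Lemma mul_cycle_laplacian (R : pzRingType) (n : nat) (s : R) (x : 'cV[R]_n)
    (i : 'I_n) :
  (cycle_laplacian n s *m x) i 0 =
  2 * pad x i.+1 + s * (pad x i + pad x i.+2).
Proof.
rewrite mxE /pad mulrDr !mulr_sumr -!big_split /=; apply: eq_bigr => j _.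
rewrite mxE /adjacent -(inj_eq val_inj) /= !mulrA -!mulrDl; congr (_ * _).
have h (a : R) (b : bool) : a * b%:R = if b then a else 0.
  by case: b; rewrite ?mulr1 ?mulr0.
rewrite !h eqSS eqSS (eq_sym (val j)) (eq_sym (val j) (i.+1)).
case: (ssrnat.ltngtP (val i) (val j)) => ij.
- by rewrite add0r (gtn_eqF (leqW ij)) add0r orbF.
- by rewrite add0r (gtn_eqF (leqW ij)) addr0.
- by rewrite ij !(gtn_eqF (ltnSn _)) /= !addr0.
Qed.

(** * Integral potentials and the reversal symmetry *)

(** If L x vanishes modulo a subgroup S of the rationals, the three-term
    recurrence determines x modulo S from x_1.  Keeping S abstract serves both
    congruences modulo Z and, with S = 0, the kernel of L. *)
Lemma alternating_recurrence (S : rat -> Prop) (n : nat) (x : 'cV[rat]_n) :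
  S 0 -> (forall u v, S u -> S v -> S (u - v)) ->
  (forall i, S ((cycle_laplacian n 1 *m x) i 0)) ->
  forall k, (k <= n.+1)%N -> S (pad x k - (-1) ^+ k.+1 * k%:R * pad x 1).
Proof.
move=> S0 SB SL k.
suff: (k <= n.+1)%N -> S (pad x k - (-1) ^+ k.+1 * k%:R * pad x 1) /\
      ((k < n.+1)%N -> S (pad x k.+1 - (-1) ^+ k.+2 * k.+1%:R * pad x 1)).
  by move=> h /h[].
elim: k => [|k IH] kn.
  by rewrite pad0 mulr0 mul0r subrr expr2 mulrNN !mul1r subrr.
have [Ek Ek1] := IH (ltnW kn); have {}Ek1 := Ek1 kn; split=> // kn1.
have ltk : (k < n)%N by lia.
have := SL (Ordinal ltk); rewrite mul_cycle_laplacian /= => SLk.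
(* x_(k+2) = (L x)_(k+1) - 2 x_(k+1) - x_k, and the same recurrence with
   zero right-hand side holds for k |-> (-1)^(k+1) k. *)
have := SB _ _ (SB _ _ (SB _ _ SLk Ek1) Ek1) Ek.
by congr S; rewrite !exprS -!natr1; ring.
Qed.

(** The alternating solution takes the value N x_1 at the sink when N is odd,
    so N x_1 is in S; the values at k and N - k then differ by N x_1 up to
    sign, because k and N - k have opposite parities. *)
Lemma reversal_congruence (S : rat -> Prop) (n : nat) (x : 'cV[rat]_n) :
  odd n.+1 -> S 0 -> (forall u v, S u -> S v -> S (u - v)) ->
  (forall i, S ((cycle_laplacian n 1 *m x) i 0)) ->
  S (n.+1%:R * pad x 1) /\
  forall k, (k <= n.+1)%N -> S (pad x k - pad x (n.+1 - k)).
Proof.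
move=> oddN S0 SB SL.
have E := alternating_recurrence S0 SB SL.
have SN u : S u -> S (- u) by move=> Su; rewrite -sub0r; exact: SB.
have SN1 : S (n.+1%:R * pad x 1).
  have := SN _ (E _ (leqnn _)); rewrite pad_gt // sub0r opprK.
  by rewrite -signr_odd /= -[~~ odd n]/(odd n.+1) oddN /= mul1r.
split=> // k kn.
have := SB _ _ (E k kn) (E (n.+1 - k)%N (leq_subr _ _)).
have -> : (-1) ^+ (n.+1 - k).+1 = (-1) ^+ k :> rat.
  rewrite -signr_odd -[in RHS]signr_odd /= oddB //.
  by rewrite oddN; case: (odd k).
rewrite natrB // exprS => SE.
have S' : S ((-1) ^+ k * (n.+1%:R * pad x 1)).
  by rewrite -signr_odd; case: odd; rewrite /= ?expr1 ?mulN1r ?mul1r //; exact: SN.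
by have := SB _ _ SE S'; congr S; ring.
Qed.

(** A kernel vector x of L has N x_1 = 0, and it is determined by x_1. *)
Lemma cycle_laplacian_unit (n : nat) :
  odd n.+1 -> cycle_laplacian n (1 : rat) \in unitmx.
Proof.
move=> oddN; rewrite unitmxE unitfE; apply/negP => /det0P[v v0 vL].
have Lv i : (cycle_laplacian n 1 *m v^T) i 0 = 0.
  have symL : (cycle_laplacian n (1 : rat))^T = cycle_laplacian n 1.
    by apply/matrixP => a b; rewrite !mxE eq_sym /adjacent orbC.
  by rewrite -symL -trmx_mul vL !mxE.
have SB (u w : rat) : u = 0 -> w = 0 -> u - w = 0 by move=> -> ->; rewrite subrr.
have [/eqP + _] := reversal_congruence (S := fun u => u = 0) oddN erefl SB Lv.
rewrite mulf_eq0 pnatr_eq0 /= => /eqP x1.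
move/negP: v0; apply; apply/eqP/rowP => i; rewrite [RHS]mxE.
have := alternating_recurrence (S := fun u => u = 0) erefl SB Lv (k := i.+1).
rewrite x1 mulr0 subr0 padE mxE; apply; exact: ltnW (ltn_ord i).
Qed.

(** The vector (1, 2, ..., n) is harmonic for M except at its last entry;
    Abel summation moves M onto it. *)
Lemma weighted_laplacian_sum (R : comPzRingType) (n : nat) (y : 'cV[R]_n) :
  \sum_(i < n) i.+1%:R * (cycle_laplacian n (-1) *m y) i 0 =
  n.+1%:R * pad y n.
Proof.
under eq_bigr do rewrite mul_cycle_laplacian.
rewrite -(big_mkord xpredT (fun i => i.+1%:R * (2 * pad y i.+1
   + -1 * (pad y i + pad y i.+2)))).
have abel p : \sum_(0 <= i < p) i.+1%:R * (2 * pad y i.+1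
   + -1 * (pad y i + pad y i.+2)) = p.+1%:R * pad y p - p%:R * pad y p.+1.
  elim: p => [|p IH]; first by rewrite big_nil pad0; ring.
  by rewrite big_nat_recr //= IH -!natr1; ring.
by rewrite abel (pad_gt _ (ltnSn _)) mulr0 subr0.
Qed.

(** * Heights of a configuration *)

Local Notation signedL n := (cycle_laplacian n (1 : int)).
Local Notation unsignedL n := (cycle_laplacian n (-1 : int)).

Definition heights (n : nat) (c : 'cV[int]_n) : 'cV[rat]_n :=
  map_mx intr (unsignedL n) *m invmx (map_mx intr (signedL n))
    *m map_mx intr c.

Lemma map_cycle_laplacian (n : nat) (s : int) :
  map_mx intr (cycle_laplacian n s) = cycle_laplacian n (s%:~R : rat).
Proof. by apply/matrixP => i j; rewrite !mxE; case: ifP => // _; case: ifP. Qed.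

Lemma heightsD (n : nat) (c d : 'cV[int]_n) :
  heights (c + d) = heights c + heights d.
Proof. by rewrite /heights map_mxD mulmxDr. Qed.

(** Adding L z to a configuration adds M z to its heights; in particular
    firing acts on heights as ordinary chip-firing. *)
Lemma heights_im (n : nat) (z : 'cV[int]_n) : odd n.+1 ->
  heights (signedL n *m z) = map_mx intr (unsignedL n *m z).
Proof.
move=> oddN; rewrite /heights !map_mxM mulmxA -(mulmxA _ (invmx _)) mulVmx.
  by rewrite mulmx1.
by rewrite map_cycle_laplacian; exact: cycle_laplacian_unit.
Qed.

Lemma heights_addE (n : nat) (c z : 'cV[int]_n) (i : 'I_n) : odd n.+1 ->
  heights (c + signedL n *m z) i 0 =
  heights c i 0 + ((unsignedL n *m z) i 0)%:~R.
Proof.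
by move=> oddN; rewrite heightsD heights_im // mxE [X in _ + X = _]mxE.
Qed.

Lemma heights_subE (n : nat) (c z : 'cV[int]_n) (i : 'I_n) : odd n.+1 ->
  heights (c - signedL n *m z) i 0 =
  heights c i 0 - ((unsignedL n *m z) i 0)%:~R.
Proof.
move=> oddN; rewrite -mulmxN heights_addE // mulmxN; congr (_ + _).
by rewrite mxE rmorphN.
Qed.

(** The vector y is the integral difference between the potential L^-1 c and
    its reversal; M commutes with the reversal. *)
Lemma heights_reversal (n : nat) (c : 'cV[int]_n) : odd n.+1 ->
  exists y : 'cV[int]_n, forall i,
    ((unsignedL n *m y) i 0)%:~R = heights c i 0 - heights c (rev_ord i) 0.
Proof.
move=> oddN.
have [x [hx Lx]] : exists x : 'cV[rat]_n,
    heights c = cycle_laplacian n (-1) *m x /\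
    cycle_laplacian n 1 *m x = map_mx intr c.
  exists (invmx (map_mx intr (signedL n)) *m map_mx intr c).
  rewrite /heights -mulmxA !map_cycle_laplacian; split=> //.
  rewrite mulmxA mulmxV ?mul1mx //.
  exact: cycle_laplacian_unit.
have Lxint i : (cycle_laplacian n 1 *m x) i 0 \is a Num.int by rewrite Lx mxE.
have [_ xrev] := reversal_congruence (S := fun u => u \is a Num.int) oddN
  (rpred0 _) (fun u v => @rpredB _ _ u v) (fun i => Lxint i).
pose y : 'cV[rat]_n := x - \col_i x (rev_ord i) 0.
exists (\col_i Num.floor (y i 0)) => i.
have fy : map_mx intr (\col_i Num.floor (y i 0)) = y.
  apply/colP => j; rewrite !mxE floorK // -!(padE x) /=.
  by have := xrev j.+1 (ltnW (ltn_ord j)); rewrite subSS -(subnSK (ltn_ord j)).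
have -> : ((unsignedL n *m (\col_i Num.floor (y i 0))) i 0)%:~R =
    (cycle_laplacian n (-1) *m y) i 0.
  by rewrite -[in RHS]fy -(map_cycle_laplacian n (-1)) -map_mxM [RHS]mxE.
rewrite /y mulmxBr hx mxE [X in _ + X]mxE; congr (_ - _).
have iN := ltn_ord i.
rewrite !mul_cycle_laplacian !pad_rev; [|lia..].
rewrite /= !subSS subnSK // -subSn; last exact: ltnW.
by rewrite [pad x (n - i.+1) + _]addrC.
Qed.

(** The difference between the heights and their reversal would be supported
    on i and its mirror image, with opposite values e and -e, where e is 1 or
    -1; the weighted sum then equals (2 (i + 1) - N) e, which N does not
    divide because N is odd and 0 < 2 (i + 1) < 2 N. *)
Lemma heights_no_exception (n : nat) (c : 'cV[int]_n) (a : rat) (i : 'I_n) :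
  odd n.+1 -> (forall k, k != i -> a <= heights c k 0 < a + 1) ->
  a - 1 <= heights c i 0 < a + 2 -> a <= heights c i 0 < a + 1.
Proof.
move=> oddN others hi.
have [y hy] := heights_reversal c oddN.
set d := unsignedL n *m y in hy.
have ri : rev_ord i != i.
  apply/eqP => /(congr1 val) /=; have := ltn_ord i; move: oddN; lia.
have hri := others _ ri.
have d0 k : k != i -> k != rev_ord i -> d k 0 = 0.
  move=> ki kri; have := hy k.
  have rki : rev_ord k != i by rewrite -(inj_eq rev_ord_inj) rev_ordK.
  have := others _ rki; have := others _ ki => h1 h2 hk.
  have : ((-1)%:~R : rat) < (d k 0)%:~R < (1%:~R : rat).
    by rewrite hk; apply/andP; split; lra.
  rewrite !ltr_int; lia.
have dri : d (rev_ord i) 0 = - d i 0.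
  by apply/(@intr_inj rat); rewrite rmorphN /= !hy rev_ordK opprB.
suff di : d i 0 = 0.
  have := hy i; rewrite di => /esym/eqP; rewrite subr_eq0 => /eqP ->; exact: hri.
have : ((-2)%:~R : rat) < (d i 0)%:~R < (2%:~R : rat).
  by rewrite hy; apply/andP; split; lra.
rewrite !ltr_int => dbound.
have := weighted_laplacian_sum y; rewrite -/d.
rewrite (bigD1 i) //= (bigD1 (rev_ord i)) //= big1 ?addr0; last first.
  by move=> k /andP[ki kri]; rewrite d0 ?mulr0.
rewrite dri; move: (pad y n) (d i 0) dbound => t e dbound ht.
have iN := ltn_ord i.
(* With e = 1 or -1 the bounds on i leave only t = 0, that is n = 2 i + 1. *)
have {ht} : (i.+1%:Z - (n - i)%N%:Z) * e = n.+1%:Z * t.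
  by move: ht; rewrite subnSK // !natz => <-; rewrite mulrN -mulrBl.
case: (e =P 0) => // e0 ht; exfalso.
have [e1|e1] : e = 1 \/ e = -1 by lia.
  have t0 : t = 0 by move: ht; rewrite e1; nia.
  by move: ht; rewrite e1 t0; move: oddN; lia.
have t0 : t = 0 by move: ht; rewrite e1; nia.
by move: ht; rewrite e1 t0; move: oddN; lia.
Qed.

(** * Chip-firing on heights *)

Lemma heights_fire (n : nat) (c : 'cV[int]_n) (i k : 'I_n) : odd n.+1 ->
  heights (fire (signedL n) i c) k 0 =
  heights c k 0 - (if k == i then 2 else if adjacent k i then -1 else 0).
Proof.
move=> oddN; rewrite /fire heights_subE // -colE !mxE.
by case: ifP => // _; case: ifP.
Qed.

Lemma ready_heights (n : nat) (c : 'cV[int]_n) (i : 'I_n) :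
  odd n.+1 -> valid (signedL n) (unsignedL n) c ->
  ready (signedL n) (unsignedL n) i c <-> 2 <= heights c i 0.
Proof.
move=> oddN vc; split=> [/(_ i)|hi k]; rewrite -/(heights _) heights_fire //.
  by rewrite eqxx; lra.
have := vc k; rewrite -/(heights _) => hk.
by case: eqP => [->|_]; [lra|case: ifP => _; lra].
Qed.

(** The first site k where z attains its maximum works: the left neighbour
    (or the sink) has a strictly smaller value, the right one a value that is
    at most equal. *)
Lemma exists_descent (n : nat) (z : 'cV[int]_n) :
  (forall i, 0 <= z i 0) -> z != 0 ->
  exists k, 1 <= z k 0 /\ 1 <= (unsignedL n *m z) k 0.
Proof.
move=> z0 zN0.
have [i0 zi0] : exists i, z i 0 != 0.
  apply/existsP; apply: contraNT zN0 => /existsPn zE.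
  by apply/eqP/colP => i; rewrite mxE; apply/eqP; have := zE i; rewrite negbK.
have := @Order.TotalTheory.arg_maxP _ _ _ i0 xpredT (fun i => z i 0) isT.
case=> kmax _ hmax.
case: (arg_minnP (P := fun k => z k 0 == z kmax 0) (fun k : 'I_n => val k) (eqxx _)).
move=> k /eqP zk kmin.
have zk1 : 1 <= z k 0 by rewrite zk; have := hmax i0 isT; have := z0 i0; lia.
exists k; split=> //; rewrite mul_cycle_laplacian padE.
have up : pad z k.+2 <= z k 0.
  case: (padP z k.+2) => [->|[j _ ->]]; first lia.
  by rewrite zk; exact: hmax.
have down : pad z k < z k 0.
  case: (padP z k) => [->|[j kj ->]]; first lia.
  rewrite zk lt_neqAle (hmax j isT : z j 0 <= z kmax 0) andbT; apply/negP => /kmin /=.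
  by rewrite kj ltnn.
by move: (pad z k) (pad z k.+2) (z k 0) up down => a b e; lia.
Qed.

(** The preimage is k (N - k) / 2 at the k-th site, integral because k and
    N - k have opposite parities. *)
Lemma laplacian_preimage_of_ones (n : nat) : odd n.+1 ->
  exists z : 'cV[int]_n, (forall i, 0 <= z i 0) /\
    forall i, (unsignedL n *m z) i 0 = 1.
Proof.
move=> oddN; pose f k := ((k * (n.+1 - k))./2)%N.
pose z : 'cV[int]_n := \col_k (f k.+1)%:Z.
exists z; split=> [i|i]; first by rewrite mxE.
have ff k : (k <= n.+1)%N -> ((f k).*2 = k * (n.+1 - k))%N.
  move=> kn; rewrite /f -[RHS]odd_double_half oddM oddB // oddN.
  by case: (odd k).
have padz k : (k <= n.+1)%N -> pad z k = (f k)%:Z.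
  case: k => [|k] kn; first by rewrite pad0 /f mul0n.
  have [kn'|nk] := ltnP k n; first by rewrite (padE z (Ordinal kn')) mxE.
  by rewrite pad_gt // /f (_ : (n.+1 - k.+1 = 0)%N) ?muln0 //; lia.
have iN := ltn_ord i.
rewrite mul_cycle_laplacian !padz; [|lia..].
have := ff i; have := ff i.+1; have := ff i.+2.
move: (f i) (f i.+1) (f i.+2) => a b e.
move=> /(_ iN) he /(_ (ltnW iN)) hb /(_ (leqW (ltnW iN))) ha.
nia.
Qed.

(** As long as the remaining script z is nonzero, exists_descent provides a
    site still to be fired whose height exceeds that of c by at least 1, hence
    is at least 2: this site can be fired legally. *)
Lemma legal_firings_back (n : nat) (c z : 'cV[int]_n) : odd n.+1 ->
  (forall i, 1 <= heights c i 0) -> (forall i, 0 <= z i 0) ->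
  valid (signedL n) (unsignedL n) (c + signedL n *m z) ->
  clos_refl_trans _ (legal_firing (signedL n) (unsignedL n))
    (c + signedL n *m z) c.
Proof.
move=> oddN hc; have [s] : exists s : nat, \sum_i z i 0 <= s%:Z.
  by exists (absz (\sum_i z i 0)); rewrite abszE ler_norm.
elim: s z => [|s IH] z zs z0 vz.
  have -> : z = 0.
    apply/colP => i; rewrite mxE; apply/eqP; rewrite eq_le z0 andbT.
    apply: le_trans zs; rewrite (bigD1 i) //= lerDl.
    by apply: sumr_ge0 => j _; exact: z0.
  by rewrite mulmx0 addr0; exact: rt_refl.
have [->|zN0] := eqVneq z 0; first by rewrite mulmx0 addr0; exact: rt_refl.
have [k [zk Mzk]] := exists_descent z0 zN0.
have rk : ready (signedL n) (unsignedL n) k (c + signedL n *m z).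
  apply/ready_heights => //; rewrite heights_addE //.
  have := hc k; have : 1%:~R <= ((unsignedL n *m z) k 0)%:~R :> rat by rewrite ler_int.
  lra.
have fk : fire (signedL n) k (c + signedL n *m z) =
    c + signedL n *m (z - delta_mx k 0).
  by rewrite /fire mulmxBr addrA.
apply: (rt_trans _ _ _ (c + signedL n *m (z - delta_mx k 0))).
  by apply: rt_step; split=> //; exists k; rewrite -fk.
apply: IH.
- have delta1 : \sum_i (delta_mx k 0 : 'cV[int]_n) i 0 = 1.
    rewrite (bigD1 k) //= mxE !eqxx big1 ?addr0 // => i /negPf ik.
    by rewrite mxE ik.
  have -> : \sum_i (z - delta_mx k 0) i 0 = \sum_i z i 0 - 1.
    by rewrite -delta1 -sumrB; apply: eq_bigr => i _; rewrite !mxE.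
  by move: zs; move: (\sum_i _) => t; lia.
- move=> i; rewrite !mxE eqxx andbT; case: eqP => [->|_]; first by rewrite subr_ge0.
  by rewrite subr0; exact: z0.
- by rewrite -fk.
Qed.

(** * Superstable and critical configurations by heights *)

Definition heights_in (n : nat) (a : rat) (c : 'cV[int]_n) : Prop :=
  forall i, a <= heights c i 0 < a + 1.

(** Firing intervals bounds the heights up to one exceptional site, which
    integrality excludes; conversely exists_descent shows that every nonzero
    script takes at least 1 from some site, which heights below 1 forbid. *)
Lemma z_superstableE (n : nat) (c : 'cV[int]_n) : odd n.+1 ->
  z_superstable (signedL n) (unsignedL n) c <-> heights_in 0 c.
Proof.
move=> oddN; split=> [[vc sc]|box].
  have h0 k : 0 <= heights c k 0 := vc k.
  (* Firing [i, j] subtracts 1 at each end, so 2 if i = j, and leaves no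
     other site with fewer chips. *)
  have interval (i j : 'I_n) : (i <= j)%N ->
      ((i == j) + 1)%:R <= heights c i 0 ->
      ((i == j) + 1)%:R <= heights c j 0 -> False.
    move=> ij hi hj; pose z : 'cV[int]_n := \col_k (i <= k <= j)%N%:R.
    apply: (sc z).
    - by move=> k; rewrite mxE; lia.
    - apply/negP => /eqP/colP/(_ i); rewrite !mxE leqnn ij.
      by move/eqP; rewrite oner_eq0.
    move=> k; rewrite -/(heights _) heights_subE // mul_cycle_laplacian.
    have padz p : pad z p = (i.+1 <= p <= j.+1)%N%:R.
      case: p => [|p]; first by rewrite pad0.
      have [pn|np] := ltnP p n; first by rewrite (padE z (Ordinal pn)) mxE.
      by rewrite pad_gt // [(_ <= j.+1)%N]leqNgt !ltnS (leq_trans (ltn_ord j)) ?andbF.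
    rewrite !padz !natz.
    set D := (X in X%:~R).
    have [/eqP ki|ki] := boolP (k == i).
      have : D <= ((i == j) + 1)%N.
        rewrite /D ki -[i == j]/(val i == val j) /=; lia.
      rewrite -(ler_int rat) -pmulrn; move: hi; rewrite ki; lra.
    have [/eqP kj|kj] := boolP (k == j).
      have : D <= ((i == j) + 1)%N.
        rewrite /D kj -[i == j]/(val i == val j) /=; lia.
      rewrite -(ler_int rat) -pmulrn; move: hj; rewrite kj; lra.
    have : D <= 0.
      by rewrite /D; move: ki kj; rewrite -!(inj_eq val_inj) /=; lia.
    rewrite -(ler_int rat); have := h0 k; lra.
  have lt2 i : heights c i 0 < 2.
    by rewrite ltNge; apply/negP => hi; apply: (interval i i); rewrite ?eqxx.
  have uniq i j : 1 <= heights c i 0 -> 1 <= heights c j 0 -> i = j.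
    move=> hi hj; apply/eqP/negP => /negP ij.
    by case: (leqP i j) => [|/ltnW] le; [apply: (interval i j)|apply: (interval j i)];
      rewrite // ?[j == i]eq_sym (negPf ij).
  move=> i; have [hi|hi] : heights c i 0 < 1 \/ 1 <= heights c i 0.
    - by case: ltP; [left|right].
    - by have := h0 i; lra.
  apply: (heights_no_exception oddN); last by have := h0 i; have := lt2 i; lra.
  move=> k ki; have : ~~ (1 <= heights c k 0).
    by apply: contra ki => hk; apply/eqP; exact: uniq.
  by rewrite -ltNge; have := h0 k; lra.
split=> [k|z z0 zN0 vz]; first by have /andP[] := box k.
have [k [_ Mk]] := exists_descent z0 zN0.
have := vz k; rewrite -/(heights _) heights_subE //.
have : 1%:~R <= ((unsignedL n *m z) k 0)%:~R :> rat by rewrite ler_int.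
have := box k; lra.
Qed.

Definition neighbours_in (n : nat) (A : {set 'I_n}) (v : 'I_n) : nat :=
  \sum_(u in A) adjacent u v.

Lemma neighbours_in_le2 (n : nat) (A : {set 'I_n}) (v : 'I_n) :
  (neighbours_in A v <= 2)%N.
Proof.
have le1 (f : 'I_n -> nat) k : injective f ->
    (\sum_(u in A) (f u == k) <= 1)%N.
  move=> finj.
  have -> : (\sum_(u in A) (f u == k) = #|[pred u in A | f u == k]|)%N.
    by rewrite -sum1_card big_mkcondr /=; apply: eq_bigr => u _; case: eqP.
  apply/card_le1_eqP => u w /andP[_ /eqP fu] /andP[_ /eqP fw].
  by apply: finj; rewrite fu fw.
apply: (@leq_trans (\sum_(u in A) ((u.+1 == v) + (val u == v.+1)))).
  by apply: leq_sum => u _; rewrite /adjacent /=; lia.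
rewrite big_split; apply: (@leq_add _ _ 1 1); last first.
  by apply: (le1 val); exact: val_inj.
by apply: (le1 (fun u => u.+1)) => u w [/val_inj].
Qed.

(** The burning criterion: a reachable configuration has no forbidden set,
    where every site has height below its number of neighbours inside the set.
    This is invariant under the firing of k: for A containing k, the invariant
    for A minus k gives a site v, and if k is a neighbour of v its firing pays
    for the neighbour k that v gains in A.  If A = {k}, the height of k is
    merely required to be nonnegative after firing. *)
Lemma reachable_recurrent (n : nat) (c : 'cV[int]_n) (A : {set 'I_n})
    (i : 'I_n) : odd n.+1 -> reachable (signedL n) (unsignedL n) c -> i \in A ->
  exists2 v, v \in A & (neighbours_in A v)%:R <= heights c v 0.
Proof.
move=> oddN [d [vd rd dc]].
elim/clos_refl_trans_ind_left: dc A i => {c} [A v vA|].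
  exists v => //; apply: le_trans (_ : 2 <= _).
    by rewrite ler_nat neighbours_in_le2.
  by apply/ready_heights.
move=> c e _ IH [vc [k [rk ->]]] A i iA.
have [kA|kA] := boolP (k \in A); last first.
  have [v vA hv] := IH A i iA; exists v => //; rewrite heights_fire //.
  have /negPf -> : v != k by apply: contraNneq kA => <-.
  by case: adjacent; lra.
have [j jA|A1] := pickP (mem (A :\ k)); last first.
  exists k => //; apply: le_trans (rk k); rewrite /neighbours_in big1 // => u uA.
  have /negbT := A1 u; rewrite /= !inE uA andbT negbK => /eqP ->.
  by rewrite /adjacent gtn_eqF.
have [v vA hv] := IH _ j jA.
exists v; first by move: vA; rewrite inE => /andP[].
have vk : v != k by move: vA; rewrite !inE => /andP[].
rewrite heights_fire // (negPf vk) /neighbours_in (big_setD1 k) //=.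
rewrite -/(neighbours_in _ _) natrD [adjacent v k]orbC.
by rewrite /adjacent; move: hv; case: ifP => _ /=; lra.
Qed.

(** Stability and the absence of forbidden intervals bound the heights up to
    one exceptional site, which integrality excludes; conversely heights at
    least 1 suffice to fire back to c from c + L z, where M z = 1. *)
Lemma criticalE (n : nat) (c : 'cV[int]_n) : odd n.+1 ->
  critical (signedL n) (unsignedL n) c <-> heights_in 1 c.
Proof.
move=> oddN; split=> [[[vc st] rc]|box].
  have h0 k : 0 <= heights c k 0 := vc k.
  have lt2 i : heights c i 0 < 2.
    by rewrite ltNge; apply/negP => hi; apply: (st i); apply/ready_heights.
  (* [i, j] would be forbidden: its ends have a neighbour inside it but
     height < 1, and the other sites have two but height < 2. *)
  have interval (i j : 'I_n) : (i < j)%N ->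
      heights c i 0 < 1 -> heights c j 0 < 1 -> False.
    move=> ij hi hj; pose A : {set 'I_n} := [set k : 'I_n | (i <= k <= j)%N]%SET.
    have iA : i \in A by rewrite inE leqnn ltnW.
    have [v] := reachable_recurrent oddN rc iA; rewrite inE => /andP[iv vj] hv.
    have right : (v < j)%N -> exists2 u, u \in A & val u = v.+1.
      move=> vlt; have un : (v.+1 < n)%N := leq_ltn_trans vlt (ltn_ord j).
      by exists (Ordinal un); rewrite // inE /= vlt leqW.
    have left : (i < v)%N -> exists2 u, u \in A & u.+1 = v.
      move=> vgt; have un : (v.-1 < n)%N := leq_ltn_trans (leq_pred v) (ltn_ord v).
      by exists (Ordinal un); rewrite ?inE /=; lia.
    have nb1 u : u \in A -> adjacent u v -> 1 <= heights c v 0.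
      move=> uA uv; apply: le_trans hv; rewrite ler1n /neighbours_in.
      by rewrite (bigD1 u) //= uv.
    have [vi|vi] := eqVneq v i.
      have [|u uA uv] := right; first by rewrite vi.
      have := nb1 u uA; rewrite /adjacent uv eqxx orbT vi => /(_ isT); lra.
    have [vj'|vj'] := eqVneq v j.
      have [|u uA uv] := left; first by rewrite vj'.
      have := nb1 u uA; rewrite /adjacent uv eqxx vj' => /(_ isT); lra.
    have [|u uA uv] := right; first by rewrite ltn_neqAle vj (inj_eq val_inj) vj'.
    have [|w wA wv] := left; first by rewrite ltn_neqAle iv eq_sym (inj_eq val_inj) vi.
    suff : (2 <= neighbours_in A v)%N by rewrite -(ler_nat rat); have := lt2 v; lra.
    have wu : w != u by apply/eqP => /(congr1 val) /=; rewrite uv -wv; lia.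
    rewrite /neighbours_in (bigD1 u) //= (bigD1 w) ?wA //=.
    by rewrite /adjacent uv wv !eqxx orbT.
  have uniq i j : heights c i 0 < 1 -> heights c j 0 < 1 -> i = j.
    move=> hi hj; apply/val_inj; case: (ssrnat.ltngtP i j) => // ij.
      by case: (interval i j).
    by case: (interval j i).
  move=> i; have [hi|hi] : heights c i 0 < 1 \/ 1 <= heights c i 0.
    - by case: ltP; [left|right].
    - apply: (heights_no_exception oddN); last by have := h0 i; lra.
      move=> k ki; have : ~~ (heights c k 0 < 1).
        by apply: contra ki => hk; apply/eqP; exact: uniq.
      by rewrite -leNgt; have := lt2 k; lra.
    by have := lt2 i; lra.
have vc : valid (signedL n) (unsignedL n) c.
  by move=> i; rewrite -/(heights _); have := box i; lra.
split.
  by split=> // i /ready_heights; have := box i; move=> b /(_ oddN vc); lra.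
(* Adding L z with M z = 1 raises every height by 1, hence to at least 2. *)
have [z [z0 Mz]] := laplacian_preimage_of_ones oddN.
have hd i : 2 <= heights (c + signedL n *m z) i 0.
  by rewrite heights_addE // Mz; have := box i; lra.
have vd : valid (signedL n) (unsignedL n) (c + signedL n *m z).
  by move=> i; rewrite -/(heights _); have := hd i; lra.
exists (c + signedL n *m z); split=> //; first by move=> i; apply/ready_heights.
by apply: legal_firings_back => // i; have := box i; lra.
Qed.

(** * The identity and the bijection *)

(** Heights of L z are integers, and 1 is the only integer in [1, 2). *)
Lemma critical_identity_heights (n : nat) (i : 'I_n) : odd n.+1 ->
  heights (critical_identity (signedL n) (unsignedL n)) i 0 = 1.
Proof.
move=> oddN; rewrite /critical_identity.
case: xgetP => [c _ [/criticalE box [z]]|none].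
  rewrite subr0 => cz; have := box oddN i; rewrite cz.
  rewrite -[signedL n *m z]add0r heights_addE // [X in X + _](_ : _ = 0); last first.
    by rewrite /heights map_mx0 mulmx0 mxE.
  rewrite add0r => h.
  have : (1%:~R : rat) <= ((unsignedL n *m z) i 0)%:~R < (2%:~R : rat) by lra.
  rewrite ler_int ltr_int => {}h.
  by apply/eqP; rewrite -[1]/(1%:~R) eqr_int; lia.
have [z [_ Mz]] := laplacian_preimage_of_ones oddN.
exfalso; apply: (none (signedL n *m z)); split; last by exists z; rewrite subr0.
apply/criticalE => // j; rewrite heights_im // mxE Mz; lra.
Qed.

Theorem theorem4p7 (m : nat) (hm : (1 <= m)%N) :
  set_bij
    (z_superstable (signed_cycle_laplacian m) (unsigned_cycle_laplacian m))
    (critical (signed_cycle_laplacian m) (unsigned_cycle_laplacian m))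
    (fun c : 'cV[int]_(2 * m) =>
       critical_identity (signed_cycle_laplacian m)
         (unsigned_cycle_laplacian m) + c).
Proof.
have oddN : odd (2 * m).+1 by rewrite /= oddM.
rewrite -[signed_cycle_laplacian m]/(signedL (2 * m)).
rewrite -[unsigned_cycle_laplacian m]/(unsignedL (2 * m)).
set eps := critical_identity _ _.
have heps (c : 'cV[int]_(2 * m)) i : heights (eps + c) i 0 = 1 + heights c i 0.
  by rewrite heightsD mxE critical_identity_heights.
split.
- move=> c /= /z_superstableE box; apply/criticalE => // i.
  by rewrite heps; have := box oddN i; lra.
- by move=> c d _ _ /addrI.
- move=> d /criticalE box; exists (d - eps); last by rewrite addrC subrK.
  apply/z_superstableE => // i; have := heps (d - eps) i.
  rewrite addrC subrK; have := box oddN i; lra.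
Qed.
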